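(* Let $A$ be a formula of $\mathcal{L}_{\mathsf{MBCL}}$ that is satisfiable in $\mathbf{F}^{dL}$, i.e. true at some world of some model whose frame belongs to $\mathbf{F}^{dL}$. Then there exist a finite model $N$ (finitely many worlds, each relating relation finite) and a world $u$ of $N$ with $N,u\vDash A$, together with a model $N'$ whose frame belongs to $\mathbf{F}^{dL}$, having the same worlds, accessibility relation and valuation as $N$, such that for every world $x$, $N,x\vDash A$ iff $N',x\vDash A$.
   Context: $\mathcal{L}_{\mathsf{MBCL}}$: variables $p_0,p_1,\dots$ ($\mathrm{Var}$), unary $\neg,\Box,\Diamond$, binary $\wedge,\vee,\rightarrow$; $\mathrm{For}$ its formulas. Demodalization $d$: $d(p)=p$, $d(\neg A)=\neg d(A)$, $d(A\star B)=d(A)\star d(B)$ for $\star\in\{\wedge,\vee,\rightarrow\}$, $d(\Box A)=d(\Diamond A)=d(A)$. A model $\langle W,Q,\{R_w\}_{w\in W},v\rangle$: $W\neq\emptyset$, $Q\subseteq W\times W$, $R_w\subseteq\mathrm{For}\times\mathrm{For}$, $v:W\times\mathrm{Var}\to\{0,1\}$; its frame is $\langle W,Q,\{R_w\}\rangle$. Truth at $w$: $p$ iff $v(w,p)=1$; $\neg,\wedge,\vee$ classical; $\Box B$ iff $B$ true at all $Q$-successors; $\Diamond B$ iff true at some $Q$-successor; $B\rightarrow C$ iff ($B$ false or $C$ true at $w$) and $R_w(B,C)$. $\mathbf{F}^{dL}$: frames where every $R_w$ satisfies, for all $A,B$: not $R(A,\neg A)$; not $R(\neg A,A)$; $R(A,B)\Rightarrow$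 not $R(A,\neg B)$; $R(A\rightarrow B,\neg(A\rightarrow\neg B))$; $R(A\rightarrow\neg B,\neg(A\rightarrow B))$; $R(d(A),d(B))\Rightarrow R(A,B)$. *)

(* Defs.v *)
From mathcomp Require Import all_boot.
From mathcomp Require Import boolp classical_sets functions cardinality.

Set Implicit Arguments.
Unset Strict Implicit.
Unset Printing Implicit Defensive.

Local Open Scope classical_set_scope.

Inductive form : Type :=
  | Var of nat
  | Neg of form
  | Box of form
  | Dia of form
  | And of form & form
  | Or of form & form
  | Imp of form & form.

Fixpoint demodalize (A : form) : form :=
  match A with
  | Var n => Var n
  | Neg B => Neg (demodalize B)
  | Box B => demodalize B
  | Dia B => demodalize B
  | And B C => And (demodalize B) (demodalize C)
  | Or B C => Or (demodalize B) (demodalize C)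
  | Imp B C => Imp (demodalize B) (demodalize C)
  end.

(* The set of worlds is a parameter, so that two models can be said to have
   the same worlds without transporting along an equality of types. *)
Record frame (W : Type) : Type := Frame {
  worlds_nonempty : inhabited W;
  acc : W -> W -> Prop;
  relating : W -> set (form * form)
}.

Record model (W : Type) : Type := Model {
  frame_of :> frame W;
  valuation : W -> nat -> bool
}.

Fixpoint truth (W : Type) (M : model W) (w : W) (A : form) : Prop :=
  match A with
  | Var n => valuation M w n = true
  | Neg B => ~ truth M w B
  | Box B => forall x, acc M w x -> truth M x B
  | Dia B => exists x, acc M w x /\ truth M x B
  | And B C => truth M w B /\ truth M w C
  | Or B C => truth M w B \/ truth M w C
  | Imp B C => (~ truth M w B \/ truth M w C) /\ relating M w (B, C)
  end.

Record dL_relation (R : set (form * form)) : Prop := DLRelation {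
  dL_a1 : forall A, ~ R (A, Neg A);
  dL_a2 : forall A, ~ R (Neg A, A);
  dL_excl : forall A B, R (A, B) -> ~ R (A, Neg B);
  dL_b1 : forall A B, R (Imp A B, Neg (Imp A (Neg B)));
  dL_b2 : forall A B, R (Imp A (Neg B), Neg (Imp A B));
  dL_demod : forall A B, R (demodalize A, demodalize B) -> R (A, B)
}.

Definition frame_dL (W : Type) (F : frame W) : Prop :=
  forall w, dL_relation (relating F w).

Definition satisfiable_dL (A : form) : Prop :=
  exists (W : Type) (M : model W) (w : W), frame_dL M /\ truth M w A.

Definition finite_model (W : Type) (M : model W) : Prop :=
  finite_set [set: W] /\ forall w, finite_set (relating M w).

(* Main.v *)
(** Filtration through the subformulas of [A]: a finite set of truth profiles is
    mapped back to worlds of the given model, and each profile inherits the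
    valuation and the whole relating relation of its representative, so the
    filtrated frame stays in the class.  Truth of [A] only consults a relating
    relation at the pairs [(B, C)] with [Imp B C] a subformula of [A]; cutting
    the relations down to these finitely many pairs gives the finite model. *)
Require Import Defs.
From HB Require Import structures.
From mathcomp Require Import all_boot.
From mathcomp Require Import boolp classical_sets functions cardinality.

Set Implicit Arguments.
Unset Strict Implicit.
Unset Printing Implicit Defensive.

Local Open Scope classical_set_scope.

HB.instance Definition _ := gen_eqMixin form.

Fixpoint subformulas (A : form) : seq form :=
  A :: match A with
       | Var _ => [::]
       | Neg B | Box B | Dia B => subformulas B
       | And B C | Or B C | Imp B C => subformulas B ++ subformulas C
       end.

Lemma mem_subformulas_self (A : form) : A \in subformulas A.
Proof. by case: A => *; rewrite /= mem_head. Qed.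

Lemma subset_cons_cat (T : eqType) (x : T) (s t u : seq T) :
  {subset x :: s ++ t <= u} -> {subset s <= u} /\ {subset t <= u}.
Proof.
by move=> h; split=> y hy; apply: h; rewrite inE mem_cat hy ?orbT.
Qed.

Lemma subset_cons_tail (T : eqType) (x : T) (s u : seq T) :
  {subset x :: s <= u} -> {subset s <= u}.
Proof. by move=> h y hy; apply: h; rewrite inE hy orbT. Qed.

Definition restrict_relating (s : seq form) (W : Type) (M : model W) : model W :=
  Model
    (Frame (worlds_nonempty M) (acc M)
       (fun w => relating M w `&` [set p | Imp p.1 p.2 \in s]))
    (valuation M).

Lemma truth_restrict_relating (s : seq form) (W : Type) (M : model W) (B : form) :
  {subset subformulas B <= s} ->
  forall w, truth (restrict_relating s M) w B <-> truth M w B.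
Proof.
elim: B => [n|B IH|B IH|B IH|B IHB C IHC|B IHB C IHC|B IHB C IHC] sub w //=.
- by have /(_ w) := IH (subset_cons_tail sub); tauto.
- have IHs := IH (subset_cons_tail sub).
  by split=> h x /h /IHs.
- have IHs := IH (subset_cons_tail sub).
  by split=> -[x [? /IHs ?]]; exists x.
- have [/IHB /(_ w) ? /IHC /(_ w) ?] := subset_cons_cat sub; tauto.
- have [/IHB /(_ w) ? /IHC /(_ w) ?] := subset_cons_cat sub; tauto.
- have [/IHB /(_ w) ? /IHC /(_ w) ?] := subset_cons_cat sub.
  have ? : Imp B C \in s by apply/sub/mem_head.
  by rewrite /setI /=; tauto.
Qed.

Lemma finite_restrict_relating (s : seq form) (W : Type) (M : model W) (w : W) :
  finite_set (relating (restrict_relating s M) w).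
Proof.
(* Each surviving pair [(B, C)] is read off from [Imp B C] in [s]; the value [(F, F)] on
   non-implications is arbitrary. *)
apply: (@sub_finite_set _ _
  ((fun F => if F is Imp B C then (B, C) else (F, F)) @` [set` s])).
  by move=> [B C] [_ /= hs]; exists (Imp B C).
exact/finite_image/finite_seq.
Qed.

(* The relating relation of [x] is that of the representative of [x], not of a
   whole class, so no compatibility between relating relations is needed. *)
Definition filtration (W V : Type) (M : model W) (cl : W -> V) (rep : V -> W) :
    model V :=
  Model
    (Frame (let: inhabits w := worlds_nonempty M in inhabits (cl w))
       (fun x y => exists2 z, acc M (rep x) z & cl z = y)
       (fun x => relating M (rep x)))
    (fun x => valuation M (rep x)).

Lemma frame_dL_filtration (W V : Type) (M : model W) (cl : W -> V) (rep : V -> W) :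
  frame_dL M -> frame_dL (filtration M cl rep).
Proof. by move=> dLM x; apply: dLM. Qed.

(** The successors of [x] are exactly the images [cl z] of successors [z] of [rep x], so the modal
    cases only compare [z] with [rep (cl z)], which agree on [s]. The implication case is
    propositional because [x] and [rep x] share one relating relation. *)
Lemma truth_filtration (s : seq form) (W V : Type) (M : model W)
    (cl : W -> V) (rep : V -> W) (B : form) :
  (forall w C, C \in s -> truth M (rep (cl w)) C <-> truth M w C) ->
  {subset subformulas B <= s} ->
  forall x, truth (filtration M cl rep) x B <-> truth M (rep x) B.
Proof.
move=> rep_cl.
elim: B => [n|B IH|B IH|B IH|B IHB C IHC|B IHB C IHC|B IHB C IHC] sub x //=.
- by have /(_ x) := IH (subset_cons_tail sub); tauto.
- have subB := subset_cons_tail sub.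
  have Bs : B \in s by apply/subB/mem_subformulas_self.
  split=> h.
    by move=> z Qz; apply/(rep_cl z B Bs)/(IH subB)/h; exists z.
  by move=> _ [z Qz <-]; apply/(IH subB)/(rep_cl z B Bs)/h.
- have subB := subset_cons_tail sub.
  have Bs : B \in s by apply/subB/mem_subformulas_self.
  split=> [[_ [[z Qz <-] /(IH subB)/(rep_cl z B Bs) ?]]|[z [Qz hz]]].
    by exists z.
  by exists (cl z); split; [exists z | apply/(IH subB)/(rep_cl z B Bs)].
- have [/IHB /(_ x) ? /IHC /(_ x) ?] := subset_cons_cat sub; tauto.
- have [/IHB /(_ x) ? /IHC /(_ x) ?] := subset_cons_cat sub; tauto.
- have [/IHB /(_ x) ? /IHC /(_ x) ?] := subset_cons_cat sub; tauto.
Qed.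

(** Indexing by positions in [s] makes the profiles a finite type, so all of them, realised or not,
    can serve as worlds. *)
Definition profile (s : seq form) (W : Type) (M : model W) (w : W) :
    {ffun 'I_(size s) -> bool} :=
  [ffun i => `[< truth M w (tnth (in_tuple s) i) >]].

Lemma profile_eq (s : seq form) (W : Type) (M : model W) (w w' : W) :
  profile s M w = profile s M w' ->
  forall C, C \in s -> truth M w C <-> truth M w' C.
Proof.
move=> eq_ww' C /(@tnthP _ _ (in_tuple s)) [i ->].
have /ffunP/(_ i) := eq_ww'; rewrite !ffunE; exact: asbool_eq_equiv.
Qed.

(* Unrealised profiles are sent to the arbitrary world [w0]. *)
Lemma profile_section (s : seq form) (W : Type) (M : model W) (w0 : W) :
  exists rep : {ffun 'I_(size s) -> bool} -> W,
    forall w, profile s M (rep (profile s M w)) = profile s M w.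
Proof.
have /choice[rep repP] : forall f, exists w,
    (exists w', profile s M w' = f) -> profile s M w = f.
  move=> f; have [[w' <-]|nf] := pselect (exists w', profile s M w' = f).
    by exists w'.
  by exists w0 => /nf.
by exists rep => w; apply: repP; exists w.
Qed.

Theorem mainTheorem15 (A : form) (hA : satisfiable_dL A) :
  exists (W : Type) (N : model W) (u : W),
    finite_model N /\ truth N u A /\
    exists N' : model W,
      frame_dL N' /\ acc N' = acc N /\ valuation N' = valuation N /\
      forall x : W, truth N x A <-> truth N' x A.
Proof.
case: hA => W [M [w [dLM MwA]]].
pose s := subformulas A.
have [rep repK] := profile_section s M w.
pose N' := filtration M (profile s M) rep.
have rep_cl v C : C \in s -> truth M (rep (profile s M v)) C <-> truth M v C.
  exact/profile_eq/repK.
have resE := @truth_restrict_relating s _ N' A (fun _ => id).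
exists {ffun 'I_(size s) -> bool}, (restrict_relating s N'), (profile s M w).
split; first by split=> [|x]; [exact: finite_finset | exact: finite_restrict_relating].
split.
  (* Truth of [A] passes from [w] to the representative of its profile, then to the profile in [N'],
     then to the restricted model. *)
  apply/resE/(truth_filtration (s := s)) => //.
  by apply/rep_cl => //; apply: mem_subformulas_self.
exists N'; split; first exact: frame_dL_filtration.
(* Restriction changes only the relating relations, so both equalities hold by computation; the
   equivalence is [resE]. *)
by do 2!split=> //.
Qed.
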